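(* For any positive integer $M$, the algorithm $\mathbf{Est\_Amp}(\mathcal A,\chi,M)$ outputs $\tilde a\in[0,1]$ such that for any positive integer $k$, $$|\tilde a-a|\le 2\pi k\frac{\sqrt{a(1-a)}}{M}+k^2\frac{\pi^2}{M^2}$$ with probability at least $8/\pi^2$ when $k=1$, and with probability greater than $1-\frac{1}{2(k-1)}$ when $k\ge2$. If $a=0$ then $\tilde a=0$ with certainty, and if $a=1$ and $M$ is even then $\tilde a=1$ with certainty.
   Context: Let $\mathcal H$ be a finite-dimensional Hilbert space with a fixed orthonormal computational basis $\{|x\rangle\}$ indexed by a finite set of nonnegative integers containing $0$. Let $\chi:\mathbb Z\to\{0,1\}$ be a Boolean function; a basis state $|x\rangle$ is good if $\chi(x)=1$. For a state $|\Upsilon\rangle$, let $|\Upsilon_1\rangle$ be its orthogonal projection onto the span of the good basis states. Let $\mathcal A$ be a unitary on $\mathcal H$, $|\Psi\rangle=\mathcal A|0\rangle$, $a=\langle\Psi_1|\Psi_1\rangle$. Let $\mathbf S_\chi|x\rangle=(-1)^{\chi(x)}|x\rangle$, $\mathbf S_0$ the unitary negating $|0\rangle$ and fixing all other basis states, and $\mathbf Q=-\mathcal A\mathbf S_0\mathcal A^{-1}\mathbf S_\chi$. For $M\ge1$, $\mathbf F_M|x\rangle=\frac{1}{\sqrt M}\sum_{y=0}^{M-1}e^{2\pi ixy/M}|y\rangle$ on an $M$-dimensional register with basis $|0\rangle,\dots,|M-1\rangle$, and for a unitary $\mathbf U$, $\Lambda_M(\mathbf U)$ is the unitary $|j\rangle|y\rangle\mapsto|j\rangle(\mathbf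 U^j|y\rangle)$ for $0\le j<M$. Algorithm $\mathbf{Est\_Amp}(\mathcal A,\chi,M)$: (1) prepare the state $|0\rangle\otimes\mathcal A|0\rangle$ (first register $M$-dimensional, second in $\mathcal H$); (2) apply $\mathbf F_M$ to the first register; (3) apply $\Lambda_M(\mathbf Q)$; (4) apply $\mathbf F_M^{-1}$ to the first register; (5) measure the first register in the computational basis, obtaining $y$; (6) output $\tilde a=\sin^2(\pi y/M)$. *)

(* Defs.v *)
From HB Require Import structures.
From mathcomp Require Import all_boot all_order all_algebra.
From mathcomp Require Import all_classical all_reals.
From mathcomp Require Import trigo.
From mathcomp Require Import complex.
Set Implicit Arguments. Unset Strict Implicit. Unset Printing Implicit Defensive.
Import Order.TTheory GRing.Theory Num.Theory.
Local Open Scope ring_scope.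

Section QAE.
Variable R : realType.
Local Notation C := (R[i]).

Definition expi (t : R) : C := Complex (cos t) (sin t).
Definition normsq (z : C) : R := (complex.Re z) ^+ 2 + (complex.Im z) ^+ 2.
Definition adjmx m p (A : 'M[C]_(m, p)) : 'M[C]_(p, m) := (map_mx (@conjc R) A)^T.
Definition unitary_mx d (A : 'M[C]_d) : Prop :=
  A *m adjmx A = 1%:M /\ adjmx A *m A = 1%:M.

(* Hilbert space H: basis |x>, x : 'I_d, labelled by the nonnegative integer
   lab x (lab injective); |0> is the basis vector i0 with lab i0 = 0. *)
Variables (d : nat) (lab : 'I_d -> nat) (i0 : 'I_d) (chi : int -> bool).

Definition good (x : 'I_d) : bool := chi (Posz (lab x)).

Definition Psi (A : 'M[C]_d) : 'cV[C]_d := A *m delta_mx i0 0.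
Definition amp (A : 'M[C]_d) : R := \sum_(x < d | good x) normsq (Psi A x 0).

Definition S_chi : 'M[C]_d :=
  \matrix_(i, j) (if i == j then (if good i then -1 else 1) else 0).
Definition S_0 : 'M[C]_d :=
  \matrix_(i, j) (if i == j then (if i == i0 then -1 else 1) else 0).
Definition Qop (A : 'M[C]_d) : 'M[C]_d := - (A *m S_0 *m invmx A *m S_chi).

Definition QFT (M : nat) : 'M[C]_M :=
  \matrix_(y, x) (Complex ((Num.sqrt (M%:R : R))^-1) 0 * expi (2 * pi * (x%:R * y%:R) / M%:R)).

(* Joint states of the M-dimensional register and H, as M x d matrices:
   entry (j, x) is the amplitude of |j>|x>. *)
Definition st1 (A : 'M[C]_d) (M : nat) : 'M[C]_(M, d) :=
  \matrix_(j, x) (if nat_of_ord j == 0%N then Psi A x 0 else 0).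
Definition st2 A M := QFT M *m st1 A M.
Definition st3 A M : 'M[C]_(M, d) :=
  \matrix_(j, x) \sum_(z < d) ((Qop A) ^+ j) x z * st2 A M j z.
Definition st4 A M := invmx (QFT M) *m st3 A M.
Definition prob_out (A : 'M[C]_d) (M : nat) (y : 'I_M) : R :=
  \sum_(x < d) normsq (st4 A M y x).
Definition est_out (M : nat) (y : 'I_M) : R := (sin (pi * y%:R / M%:R)) ^+ 2.

End QAE.

(* Main.v *)
(** Write [a = sin theta ^+ 2].  In the basis of the normalised good and bad
    components of [Psi], the operator [Q] is the rotation by [2 theta], so
    [Q ^+ j Psi] has components [sin ((2 j + 1) theta)] and
    [cos ((2 j + 1) theta)].  The inverse Fourier transform turns these into
    geometric sums, and the outcome [y] has probability
    [(F (theta - pi y / M) + F (pi - theta - pi y / M)) / 2], where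
    [F t = sin (M t) ^+ 2 / (M sin t) ^+ 2] is the normalised Fejer kernel: the
    output is an even mixture of two phase estimations, of [theta] and of
    [pi - theta], whose squared sines are both [a].

    For the phase [phi = pi (f + d) / M] with [0 <= d < 1], the two outcomes
    nearest to [phi] have total probability at least
    [sin (pi d) ^+ 2 (d ^- 2 + (1 - d) ^- 2) / pi ^+ 2 >= 8 / pi ^+ 2], and
    Jordan's inequality bounds the mass at distance more than [k] steps by
    [1 / 2] times the tail [\sum_(j >= k) j ^- 2 < (k - 1)^-1].  A phase error
    of at most [pi k / M] changes the squared sine by at most the stated bound. *)

Require Import Defs.
From HB Require Import structures.
From mathcomp Require Import all_boot all_order all_algebra.
From mathcomp Require Import all_classical all_reals.
From mathcomp Require Import trigo.
From mathcomp Require Import complex.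
From mathcomp Require Import topology normedtype derive.
From mathcomp Require Import ring lra.
Set Implicit Arguments. Unset Strict Implicit. Unset Printing Implicit Defensive.
Import Order.TTheory GRing.Theory Num.Theory.
Import numFieldNormedType.Exports.
Local Open Scope ring_scope.

(** * Elementary bounds on [sin], [cos] and [pi] *)

Section TrigBounds.
Variable R : realType.
Implicit Types t x d : R.

(** By the mean value theorem. The three Taylor bounds below follow by iterating it: the difference
    in each has the previous difference as derivative. *)
Lemma nonneg_of_derive_nonneg (f df : R -> R) :
  (forall x, is_derive x 1 f (df x)) -> f 0 = 0 ->
  (forall x, 0 <= x -> 0 <= df x) -> forall x, 0 <= x -> 0 <= f x.
Proof.
move=> fdf f0 df0 x; rewrite le_eqVlt => /predU1P[<-|x0]; first by rewrite f0.
have [|c /[!in_itv]/= /andP[c0 _]] := MVT x0 (fun y _ => fdf y).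
  apply: continuous_subspaceT => y.
  by apply: differentiable_continuous; exact/derivable1_diffP/ex_derive.
by rewrite f0 !subr0 => ->; rewrite mulr_ge0 ?df0 ?ltW.
Qed.

Lemma sin_le_id x : 0 <= x -> sin x <= x.
Proof.
move=> x0; rewrite -subr_ge0.
apply: (@nonneg_of_derive_nonneg (fun x => x - sin x) (fun x => 1 - cos x)) => //.
  by rewrite sin0 subr0.
by move=> y _; rewrite subr_ge0 cos_le1.
Qed.

Lemma cos_ge_taylor2 x : 0 <= x -> 1 - x ^+ 2 / 2 <= cos x.
Proof.
move=> x0; rewrite -subr_ge0.
apply: (@nonneg_of_derive_nonneg
  (fun x => cos x - (1 - x ^+ 2 / 2)) (fun x => x - sin x)) => //.
- move=> y; apply: is_derive_eq.
  by rewrite /GRing.scale/=; field.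
- by rewrite cos0; ring.
- by move=> y y0; rewrite subr_ge0 sin_le_id.
Qed.

Lemma sin_ge_taylor3 x : 0 <= x -> x - x ^+ 3 / 6 <= sin x.
Proof.
move=> x0; rewrite -subr_ge0.
apply: (@nonneg_of_derive_nonneg
  (fun x => sin x - (x - x ^+ 3 / 6)) (fun x => cos x - (1 - x ^+ 2 / 2))) => //.
- move=> y; apply: is_derive_eq.
  by rewrite /GRing.scale/=; field.
- by rewrite sin0; ring.
- by move=> y y0; rewrite subr_ge0 cos_ge_taylor2.
Qed.

(* Jordan's inequality, from concavity: compare the mean slopes of [sin] on
   [[0, t]] and on [[t, pi / 2]]. *)
Lemma sin_ge_chord t : 0 <= t <= pi / 2 -> 2 * t <= pi * sin t.
Proof.
move=> /andP[]; rewrite le_eqVlt => /predU1P[<- _|t0]; first by rewrite sin0 !mulr0.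
rewrite le_eqVlt => /predU1P[->|tpi]; first by rewrite sin_pihalf; lra.
have sc (a b : R) : ({within `[a, b], continuous (@sin R)})%classic.
  by apply: continuous_subspaceT => y; exact: continuous_sin.
have [c1 /[!in_itv]/= /andP[c10 c1t]] := MVT t0 (fun y _ => is_derive_sin y) (sc _ _).
rewrite sin0 !subr0 => e1.
have [c2 /[!in_itv]/= /andP[c2t c2p]] := MVT tpi (fun y _ => is_derive_sin y) (sc _ _).
rewrite sin_pihalf => e2.
have c12 : cos c2 < cos c1.
  by rewrite ltr_cos ?in_itv/=; have := @pi_gt0 R; lra.
have := @pi_gt0 R; move: tpi e1 e2; move: (sin t) (pi : R) => s p tp e1 e2 p0.
suff : 0 <= s * (p / 2 - t) - t * (1 - s) by lra.
have -> : s * (p / 2 - t) - t * (1 - s) = (cos c1 - cos c2) * t * (p / 2 - t).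
  by rewrite e2 e1; ring.
by rewrite !mulr_ge0 //; lra.
Qed.

(** The triple-angle formula at [pi / 6] reads [3 s - 4 s^3 = 1], that is [(s + 1) (2 s - 1)^2 = 0],
    and [s] is positive. *)
Lemma sin_pi6 : sin (pi / 6) = 1 / 2 :> R.
Proof.
have e : sin (pi / 6 + (pi / 6 + pi / 6)) = 1 :> R.
  by rewrite -[RHS]sin_pihalf; congr sin; field.
move: e; rewrite sinD cosD sinD.
have h := cos2sin2 (pi / 6 : R).
have : 0 < sin (pi / 6) :> R.
  by apply: sin_gt0_pi; have := @pi_gt0 R; lra.
move: h; move: (sin _) (cos _) => s c h s0 e.
have e' : s * c ^+ 2 = s * (1 - s ^+ 2) by rewrite h.
have /eqP : (s + 1) * (2 * s - 1) ^+ 2 = 0 by lra.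
rewrite mulf_eq0 sqrf_eq0 => /orP[]/eqP; lra.
Qed.

Lemma pi_ge3 : 3 <= pi :> R.
Proof.
have := @sin_le_id (pi / 6); rewrite sin_pi6 => /(_ _) h.
by have : 1 / 2 <= pi / 6 :> R; [apply: h; have := @pi_gt0 R|]; lra.
Qed.

Lemma pi2_le10 : pi ^+ 2 <= 10 :> R.
Proof.
set x : R := pi / 6.
have x0 : 0 <= x by rewrite /x; have := @pi_gt0 R; lra.
have x1 : x <= 2 / 3 by rewrite /x; have := @pihalf_lt2 R; lra.
have := sin_ge_taylor3 x0; rewrite sin_pi6 => h.
(* [6 * 0.527 = 3.162], whose square is just below 10, while [b - b^3 / 6 > 1 / 2] at
   [b = 0.527]. *)
have : x <= 527 / 1000.
  rewrite leNgt; apply/negP => x2.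
  pose b : R := 527 / 1000; have eb : b = 527 / 1000 by [].
  (* The product is [g x - g b] for [g t = t - t^3 / 6]; the crude bound [x <= 2 / 3] makes the
     second factor positive. *)
  have : 0 <= (x - b) * (1 - (x ^+ 2 + x * b + b ^+ 2) / 6).
    by rewrite mulr_ge0 //; [lra | nra].
  by rewrite eb; lra.
have -> : pi = 6 * x by rewrite /x; field.
by nra.
Qed.

End TrigBounds.

(** * Squared moduli, unit complex numbers and their geometric sums *)

Section ComplexExponential.
Variable R : realType.
Implicit Types (s t : R) (z w : R[i]).

Lemma normsq_ge0 z : 0 <= normsq z.
Proof. by rewrite addr_ge0 ?sqr_ge0. Qed.

Lemma normsqE z : (normsq z)%:C%C = conjc z * z.
Proof.
by case: z => a b; rewrite /normsq; apply/eqP; rewrite eq_complex /=; apply/andP;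
  split; apply/eqP; ring.
Qed.

Lemma normsqM z w : normsq (z * w) = normsq z * normsq w.
Proof. by case: z w => [a b] [c d]; rewrite /normsq /=; ring. Qed.

Lemma normsqJ z : normsq (conjc z) = normsq z.
Proof. by case: z => a b; rewrite /normsq /= sqrrN. Qed.

Lemma normsq_real (x : R) : normsq x%:C%C = x ^+ 2.
Proof. by rewrite /normsq /= expr0n addr0. Qed.

Lemma normsq_eq0 z : normsq z = 0 -> z = 0.
Proof.
case: z => a b /eqP; rewrite /normsq /= paddr_eq0 ?sqr_ge0 // !sqrf_eq0.
by case/andP => /eqP -> /eqP ->.
Qed.

Lemma conjcM z w : conjc (z * w) = conjc z * conjc w.
Proof. exact: rmorphM. Qed.

Lemma expiD s t : expi (s + t) = expi s * expi t.
Proof.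
by apply/eqP; rewrite eq_complex /= cosD sinD eqxx /= addrC.
Qed.

Lemma expi0 : expi 0 = 1 :> R[i].
Proof. by rewrite /expi cos0 sin0. Qed.

Lemma conj_expi t : conjc (expi t) = expi (- t).
Proof. by rewrite /expi cosN sinN. Qed.

Lemma expi_nat_2pi (n : nat) t : expi (t + 2 * pi * n%:R) = expi t.
Proof.
have -> : 2 * pi * n%:R = pi *+ 2 *+ n :> R by rewrite mulr_natr mulr_natl.
by rewrite /expi (periodicn (@cosD2pi R)) (periodicn (@sinD2pi R)).
Qed.

Lemma normsq_expiB1 s : normsq (expi (2 * s) - 1) = 4 * sin s ^+ 2.
Proof.
rewrite /normsq /= subr0 mulr_natl sin_mulr2n cos_mulr2n mulr2n.
by rewrite -[_ *+ 2]mulr_natr -[_ *+ 2]mulr_natr exprMn exprMn cos2sin2; ring.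
Qed.

(** Left undivided, so that it also covers [expi (2 * t) = 1]. *)
Lemma geom_expi M t :
  (\sum_(j < M) expi (2 * j%:R * t)) * (expi (2 * t) - 1) = expi (2 * (M%:R * t)) - 1.
Proof.
elim: M => [|M IH]; first by rewrite big_ord0 !mul0r mulr0 expi0 subrr.
rewrite big_ord_recr /= mulrDl IH mulrBr -expiD mulr1 -[M.+1%:R]natr1.
rewrite (_ : 2 * M%:R * t + 2 * t = 2 * ((M%:R + 1) * t)); last by ring.
by rewrite (mulrA 2 M%:R) addrC subrKA.
Qed.

End ComplexExponential.

(** * The normalised Fejer kernel: symmetries, period and closed form *)

Section FejerKernel.
Variable R : realType.
Implicit Types (s t : R).

(* [(sin (M t) / (M sin t)) ^+ 2], in the form that also makes sense at [sin t = 0]. *)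
Definition fejer (M : nat) t : R :=
  normsq (\sum_(j < M) expi (2 * j%:R * t)) / M%:R ^+ 2.

Lemma fejer_ge0 M t : 0 <= fejer M t.
Proof. by rewrite divr_ge0 ?normsq_ge0 ?sqr_ge0. Qed.

Lemma fejerN M t : fejer M (- t) = fejer M t.
Proof.
rewrite /fejer -normsqJ rmorph_sum; congr (normsq _ / _).
by apply: eq_bigr => j _; rewrite [LHS]conj_expi mulrN opprK.
Qed.

Lemma fejerDpi M t : fejer M (t + pi) = fejer M t.
Proof.
rewrite /fejer; congr (normsq _ / _); apply: eq_bigr => j _.
by rewrite mulrDr (_ : 2 * j%:R * pi = 2 * pi * j%:R) ?expi_nat_2pi //; ring.
Qed.

Lemma fejerBpi M t : fejer M (pi - t) = fejer M t.
Proof. by rewrite addrC fejerDpi fejerN. Qed.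

Lemma fejer0 M : (0 < M)%N -> fejer M 0 = 1.
Proof.
move=> M0; rewrite /fejer.
under eq_bigr do rewrite mulr0 expi0.
rewrite sumr_const card_ord -(rmorph_nat (real_complex R)) normsq_real divff //.
by rewrite expf_eq0 /= pnatr_eq0 -lt0n.
Qed.

(** Squared moduli in [geom_expi], with [normsq_expiB1] applied to both differences. *)
Lemma fejer_sin M t : fejer M t * (M%:R * sin t) ^+ 2 = sin (M%:R * t) ^+ 2.
Proof.
case: M => [|M]; first by rewrite !mul0r sin0 expr0n mulr0.
have M0 : M.+1%:R != 0 :> R by rewrite pnatr_eq0.
apply: (mulfI (x := 4)); first by rewrite pnatr_eq0.
rewrite -normsq_expiB1 -geom_expi normsqM normsq_expiB1 /fejer.
by move: (normsq _) (M.+1%:R) M0 => X m m0; field.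
Qed.

End FejerKernel.

(** * Unitary matrices, the Fourier transform and the total mass of the kernel *)

Section Unitarity.
Variable R : realType.

Lemma adjmxE m n (A : 'M[R[i]]_(m, n)) i j : adjmx A i j = conjc (A j i).
Proof. by rewrite !mxE. Qed.

Lemma adjmxM m n p (A : 'M[R[i]]_(m, n)) (B : 'M[R[i]]_(n, p)) :
  adjmx (A *m B) = adjmx B *m adjmx A.
Proof. by rewrite /adjmx map_mxM trmx_mul. Qed.

Lemma sum_normsqE d (v : 'cV[R[i]]_d) :
  (\sum_(x < d) normsq (v x 0))%:C%C = (adjmx v *m v) 0 0.
Proof.
by rewrite rmorph_sum mxE; apply: eq_bigr => x _; rewrite [LHS]normsqE !mxE.
Qed.

Lemma unitary_sum_normsq d (U : 'M[R[i]]_d) (v : 'cV[R[i]]_d) : adjmx U *m U = 1%:M ->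
  \sum_(x < d) normsq ((U *m v) x 0) = \sum_(x < d) normsq (v x 0).
Proof.
move=> UU; apply: complexI; rewrite !sum_normsqE adjmxM.
by rewrite mulmxA -(mulmxA (adjmx v)) UU mulmx1.
Qed.

Lemma invmx_unitary d (U : 'M[R[i]]_d) : unitary_mx U -> invmx U = adjmx U.
Proof.
case=> UU' _; have Uu : U \in unitmx by have [] := mulmx1_unit UU'.
by rewrite -[RHS](mulKmx Uu) UU' mulmx1.
Qed.

(** Entry [(x, y)] of the product is a geometric sum at [t = pi (x - y) / M]. Off the diagonal
    [sin (M t) = 0] but [sin t != 0], so [fejer_sin] forces the sum to vanish. *)
Lemma QFT_unitary M : unitary_mx (QFT R M).
Proof.
suff UU : QFT R M *m adjmx (QFT R M) = 1%:M by split=> //; exact: mulmx1C.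
apply/matrixP => x y; rewrite !mxE.
have M0 : (0 < M)%N by case: x => x /=; case: (M).
have MR : M%:R != 0 :> R by rewrite pnatr_eq0 -lt0n.
pose t : R := pi * (x%:R - y%:R) / M%:R.
transitivity ((M%:R^-1)%:C%C * \sum_(j < M) expi (2 * j%:R * t)).
  rewrite big_distrr /=; apply: eq_bigr => j _; rewrite !mxE conjcM conj_expi.
  rewrite mulrACA -expiD; congr (_ * expi _); last by rewrite /t; field.
  apply/eqP; rewrite eq_complex /= oppr0 !mulr0 subr0 mul0r addr0 eqxx andbT.
  by rewrite -invfM -expr2 sqr_sqrtr.
have [exy|nxy] := eqVneq x y.
  rewrite /t exy subrr mulr0 mul0r; under eq_bigr do rewrite mulr0 expi0.
  rewrite sumr_const card_ord -(rmorph_nat (real_complex R)) -rmorphM mulVf //.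
suff -> : \sum_(j < M) expi (2 * j%:R * t) = 0 by rewrite mulr0.
apply: normsq_eq0; apply/eqP; move: (fejer_sin M t).
have -> : M%:R * t = pi * x%:R - pi * y%:R by rewrite /t; field.
have sn (m : nat) : sin (pi * m%:R) = 0 :> R.
  by rewrite mulr_natr -[_ *+ _]add0r (alternatingn (@sinDpi R)) sin0 mulr0.
rewrite sinB !sn mul0r mulr0 subr0 expr0n /= => /eqP.
have st : sin t != 0.
  have Mp : 0 < M%:R :> R by rewrite ltr0n.
  (* Distinct indices below [M] differ by less than [M]. *)
  have tp : 0 < `|t| < pi.
    rewrite normr_gt0 /t !mulf_eq0 invr_eq0 (negbTE MR) orbF subr_eq0 eqr_nat.
    rewrite (gt_eqF (pi_gt0 R)) nxy /= !normrM (ger0_norm (pi_ge0 R)) normfV (ger0_norm (ltW Mp)).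
    rewrite ltr_pdivrMr // ltr_pM2l ?pi_gt0 //.
    have [] := (ltn_ord x, ltn_ord y); rewrite -!(ltr_nat R) => hx hy.
    by rewrite ltr_norml; have := (ler0n R x, ler0n R y); case=> *; lra.
  have := sin_gt0_pi tp; case: (ger0P t) => _; first by move=> /gt_eqF ->.
  by rewrite sinN oppr_gt0 => /lt_eqF ->.
rewrite /fejer !mulf_eq0 invr_eq0 !mulf_eq0.
by rewrite (negbTE MR) (negbTE st) !orbF.
Qed.

(** The inverse Fourier transform of the unit vector [v] has the kernel values as squared moduli,
    and a unitary preserves the norm. *)
Lemma sum_fejer M (phi : R) : (0 < M)%N ->
  \sum_(y < M) fejer M (phi - pi * y%:R / M%:R) = 1.
Proof.
move=> M0; have MR : M%:R != 0 :> R by rewrite pnatr_eq0 -lt0n.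
pose v : 'cV[R[i]]_M := \col_j ((Num.sqrt M%:R)^-1%:C%C * expi (2 * j%:R * phi)).
have [_ _] := QFT_unitary M.
have U : adjmx (adjmx (QFT R M)) *m adjmx (QFT R M) = 1%:M.
  have -> : adjmx (adjmx (QFT R M)) = QFT R M.
    by apply/matrixP => i j; rewrite !mxE conjcK.
  by case: (QFT_unitary M).
have sM : (Num.sqrt M%:R)^-1 ^+ 2 = M%:R^-1 :> R by rewrite exprVn sqr_sqrtr.
transitivity (\sum_(x < M) normsq (v x 0)); last first.
  under eq_bigr do rewrite mxE normsqM normsq_real sM /normsq /= cos2Dsin2 mulr1.
  by rewrite sumr_const card_ord -[LHS]mulr_natl mulfV.
rewrite -(unitary_sum_normsq _ U); apply: eq_bigr => y _; rewrite mxE /fejer.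
rewrite -[_ / _ ^+ 2]mulrC -exprVn -normsq_real -normsqM big_distrr /=.
congr normsq; apply: eq_bigr => j _; rewrite !mxE conjcM conj_expi.
rewrite mulrACA -expiD; congr (_ * expi _); last by field.
apply/eqP; rewrite eq_complex /= oppr0 !mulr0 subr0 mul0r addr0 eqxx andbT.
by rewrite -expr2 sM.
Qed.

End Unitarity.

(** * Mass of the Fejer kernel near and far from a phase *)

Section PhaseEstimation.
Variable R : realType.
Implicit Types (r d phi : R) (M k f : nat).

(* Near [d = 0] the cubic Taylor bound of [sin] suffices, and near [d = 1 / 2]
   the quadratic one of [cos]; both are used with [3 <= pi] and [pi ^+ 2 <= 10]. *)
Lemma inv_sqr_distance_sum_ge d : 0 < d < 1 ->
  8 <= sin (pi * d) ^+ 2 * (d ^- 2 + (1 - d) ^- 2).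
Proof.
wlog dle : d / d <= 1 / 2.
  move=> H d01; case: (lerP d (1 / 2)) => h; first exact: H.
  have := H (1 - d); rewrite (_ : pi * (1 - d) = - (pi * d) + pi); last by ring.
  rewrite sinDpi sinN opprK (_ : 1 - (1 - d) = d); last by ring.
  by rewrite [(1 - d) ^- 2 + _]addrC; apply; lra.
move=> /andP[d0 d1].
have e : d ^- 2 + (1 - d) ^- 2 = (1 - 2 * d + 2 * d ^+ 2) / (d * (1 - d)) ^+ 2.
  by field; rewrite !gt_eqF //; lra.
have dd : 0 < d * (1 - d) by rewrite mulr_gt0 // subr_gt0.
rewrite e mulrA ler_pdivlMr ?exprn_gt0 //.
have p3 := @pi_ge3 R; have p10 := @pi2_le10 R.
have c0 : 0 <= 1 - 2 * d + 2 * d ^+ 2 by nra.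
(* At the cut [11 / 50] the polynomial inequalities of both branches hold with room to spare. *)
have [d22|d22] := lerP d (11 / 50).
  have sx : pi * d * (1 - 5 * d ^+ 2 / 3) <= sin (pi * d).
    have pd0 : 0 <= pi * d by rewrite mulr_ge0 //; lra.
    apply: le_trans (sin_ge_taylor3 pd0).
    rewrite -subr_ge0 (_ : _ - _ = pi * d * d ^+ 2 * (10 - pi ^+ 2) / 6); last by field.
    by rewrite !mulr_ge0 ?sqr_ge0 ?subr_ge0 //; lra.
  have a0 : 0 <= 1 - 5 * d ^+ 2 / 3 by nra.
  apply: (@le_trans _ _ ((3 * d * (1 - 5 * d ^+ 2 / 3)) ^+ 2 * (1 - 2 * d + 2 * d ^+ 2))).
    rewrite -subr_ge0.
    rewrite (_ : _ - _ = d ^+ 2 *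
      ((3 - 5 * d ^+ 2) ^+ 2 * (1 - 2 * d + 2 * d ^+ 2) - 8 * (1 - d) ^+ 2)); last by field.
    rewrite mulr_ge0 ?sqr_ge0 // subr_ge0.
    have -> : 8 * (1 - d) ^+ 2 = 8 * (1 - 2 * d + d ^+ 2) by ring.
    have : 9 - 30 * d ^+ 2 <= (3 - 5 * d ^+ 2) ^+ 2 by nra.
    nra.
  rewrite ler_wpM2r // ler_sqr ?nnegrE ?mulr_ge0 //; last 2 first.
  - by lra.
  - by apply: le_trans sx; rewrite !mulr_ge0 //; lra.
  by apply: le_trans sx; rewrite ler_wpM2r // ler_wpM2r // ltW.
(* Equality holds at [d = 1 / 2]. The rational factors are polynomials in [w], and the final
   difference splits off a factor [w]. *)
pose w : R := (1 / 2 - d) ^+ 2.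
have w0 : 0 <= w by rewrite sqr_ge0.
have w1 : w <= 784 / 10000 by rewrite /w; nra.
have sx : 1 - 5 * w <= sin (pi * d).
  have y0 : 0 <= pi * (1 / 2 - d) by rewrite mulr_ge0 //; lra.
  have := cos_ge_taylor2 y0.
  rewrite -[cos _]sinDpihalf.
  have -> : pi * (1 / 2 - d) + pi / 2 = - (pi * d) + pi by field.
  rewrite sinDpi sinN opprK exprMn -/w; nra.
have -> : 1 - 2 * d + 2 * d ^+ 2 = 1 / 2 + 2 * w by rewrite /w; field.
have -> : d * (1 - d) = 1 / 4 - w by rewrite /w; field.
apply: (@le_trans _ _ ((1 - 5 * w) ^+ 2 * (1 / 2 + 2 * w))).
  rewrite -subr_ge0 (_ : _ - _ = w * (1 - 31 / 2 * w + 50 * w ^+ 2)); last by field.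
  by rewrite mulr_ge0 //; nra.
by rewrite ler_wpM2r ?ler_sqr ?nnegrE //; lra.
Qed.

(** Telescoping: [i^-2 <= (i - 1)^-1 - i^-1]. Strictness comes from the dropped end term, or from
    the sum being empty. *)
Lemma sum_inv_sqr_tail_lt N k : (1 < k)%N ->
  \sum_(i < N | (k <= i)%N) (i%:R : R) ^- 2 < (k%:R - 1)^-1.
Proof.
move=> k1; have k1R : 0 < k%:R - 1 :> R by rewrite subr_gt0 ltr1n.
rewrite -(big_geq_mkord _ _ predT (fun i => (i%:R : R) ^- 2)).
have [Nk|kN] := leqP N k; first by rewrite big_geq // invr_gt0.
pose u (i : nat) : R := - (i%:R - 1)^-1.
apply: (@le_lt_trans _ _ (\sum_(k <= i < N) (u i.+1 - u i))); last first.
  rewrite telescope_sumr ?(ltnW kN) // /u opprK addrC gtrDl oppr_lt0 invr_gt0.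
  by rewrite subr_gt0 ltr1n (ltn_trans k1).
rewrite !big_nat; apply: ler_sum => i /andP[ki _].
have i1 : 0 < i%:R - 1 :> R by rewrite subr_gt0 ltr1n (leq_trans k1).
rewrite /u -natr1 opprK addrK; move: i1; move: (i%:R : R) => x x1.
rewrite -subr_ge0 (_ : _ - _ = (x - 1)^-1 * x ^- 2).
  by rewrite mulr_ge0 ?invr_ge0 ?sqr_ge0 // ltW.
by field; rewrite !gt_eqF //; lra.
Qed.

(** Jordan's inequality bounds the denominator when [r <= M / 2]; otherwise the symmetry
    [t -> pi - t] exchanges [r] and [M - r]. Adding both terms gives one bound for the two cases. *)
Lemma fejer_le M r : 0 < r < M%:R ->
  fejer M (pi * r / M%:R) <= (r ^- 2 + (M%:R - r) ^- 2) / 4.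
Proof.
have aux (s : R) : 0 < s < M%:R -> s <= M%:R / 2 -> fejer M (pi * s / M%:R) <= s ^- 2 / 4.
  move=> /andP[s0 sM] s2; have M0 : 0 < M%:R :> R by exact: lt_trans s0 sM.
  have p0 := @pi_gt0 R.
  have chord : 2 * s <= M%:R * sin (pi * s / M%:R).
    have /sin_ge_chord : 0 <= pi * s / M%:R <= pi / 2.
      rewrite !mulr_ge0 ?invr_ge0 ?(ltW p0) ?(ltW s0) ?(ltW M0) //=.
      by rewrite -mulrA ler_pM2l // ler_pdivrMr //; lra.
    rewrite -(ler_pM2l (x := M%:R / pi)) ?divr_gt0 //.
    rewrite (_ : _ * (2 * _) = 2 * s); last first.
      by move: (pi : R) (M%:R : R) p0 M0 => p N p0 N0; field; rewrite !gt_eqF.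
    by rewrite -[M%:R / pi * _]mulrA mulKf // gt_eqF.
  have le1 : fejer M (pi * s / M%:R) * (2 * s) ^+ 2 <= 1.
    apply: (@le_trans _ _ (fejer M (pi * s / M%:R) * (M%:R * sin (pi * s / M%:R)) ^+ 2)).
      by rewrite ler_wpM2l ?fejer_ge0 // ler_sqr ?nnegrE //; [lra | apply: le_trans chord; lra].
    by rewrite fejer_sin sin2cos2 lerBlDr lerDl sqr_ge0.
  have -> : s ^- 2 / 4 = 1 / (2 * s) ^+ 2 by field; rewrite gt_eqF.
  by rewrite ler_pdivlMr // exprn_gt0 // mulr_gt0.
move=> /andP[r0 rM]; have M0 : 0 < M%:R :> R by exact: lt_trans r0 rM.
have r2 : 0 <= r ^- 2 by rewrite invr_ge0 sqr_ge0.
have Mr2 : 0 <= (M%:R - r) ^- 2 by rewrite invr_ge0 sqr_ge0.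
have [rh|rh] := lerP r (M%:R / 2).
  by apply: le_trans (aux r _ rh) _; [rewrite r0 | lra].
rewrite -fejerBpi (_ : pi - _ = pi * (M%:R - r) / M%:R); last first.
  by field; rewrite gt_eqF.
by apply: le_trans (aux _ _ _) _; lra.
Qed.

(** From [sin t <= t] in the denominator; the product form includes [r = 0]. *)
Lemma fejer_ge M r : 0 <= r <= M%:R ->
  sin (pi * r) ^+ 2 <= fejer M (pi * r / M%:R) * (pi * r) ^+ 2.
Proof.
case: M => [|M] /andP[r0 rM].
  have -> : r = 0 by apply/le_anti; rewrite r0 andbT.
  by rewrite mulr0 sin0 expr0n mulr0.
have M0 : 0 < M.+1%:R :> R by rewrite ltr0n.
have e : pi * r = M.+1%:R * (pi * r / M.+1%:R) by rewrite [RHS]mulrC divfK // gt_eqF.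
rewrite {1}e -fejer_sin ler_wpM2l ?fejer_ge0 //.
have t0 : 0 <= pi * r / M.+1%:R by rewrite !mulr_ge0 ?pi_ge0 ?invr_ge0.
have s0 : 0 <= sin (pi * r / M.+1%:R).
  by apply: sin_ge0_pi; rewrite t0 -mulrA ger_pMr ?pi_gt0 // ler_pdivrMr // mul1r.
rewrite {2}e ler_sqr ?nnegrE ?(mulr_ge0 (ler0n _ _)) //.
by rewrite ler_wpM2l // sin_le_id.
Qed.

Lemma fejerDnpi M t (n : nat) : fejer M (t + pi * n%:R) = fejer M t :> R.
Proof.
elim: n => [|n IH]; first by rewrite mulr0 addr0.
by rewrite -natr1 mulrDr mulr1 addrA fejerDpi.
Qed.

(** * Outcomes near the phase [pi (f + d) / M], for an event containing them *)

Section Window.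
Variables (m f : nat) (d : R).
Hypothesis d01 : 0 <= d < 1.
Local Notation M := m.+1.
Let phi : R := pi * (f%:R + d) / M%:R.

Variables (k : nat) (E : pred 'I_M).
(** The integer [e] makes closeness a matter of phases modulo [pi], the period of the kernel and of
    the squared sine. *)
Hypothesis near_E : forall (y : 'I_M) (e : int),
  `|phi - pi * y%:R / M%:R - pi * e%:~R| <= pi * k%:R / M%:R -> E y.

(* Outcome [y] is reindexed by its offset [i] from [f] modulo [M]. *)
Let shift (i : 'I_M) : 'I_M := (inZp f + i)%R.

Let shift_divn (i : 'I_M) :
  phi - pi * (shift i)%:R / M%:R =
  pi * (d - i%:R) / M%:R + pi * ((f + i) %/ M)%:R.
Proof.
have M0 : M%:R != 0 :> R by rewrite pnatr_eq0.
have -> : (shift i : nat) = ((f + i) %% M)%N by rewrite /= modnDml.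
have := congr1 (fun x => x%:R : R) (divn_eq (f + i) M); rewrite !natrD natrM.
move: (_ %/ _)%N (_ %% _)%N => q y h.
have -> : y%:R = f%:R + i%:R - q%:R * M%:R :> R by rewrite h addrAC subrr add0r.
by rewrite /phi; move: M%:R M0 => N N0; field.
Qed.

Let near_shift (i : 'I_M) :
  `|i%:R - d| <= k%:R \/ M%:R - i%:R + d <= k%:R -> E (shift i).
Proof.
have M0 : 0 < M%:R :> R by rewrite ltr0n.
have p0 := @pi_gt0 R.
case=> h.
  apply: (near_E (e := ((f + i) %/ M)%N)).
  rewrite shift_divn -pmulrn addrK -!mulrA normrM (gtr0_norm p0) ler_pM2l //.
  by rewrite normrM (gtr0_norm (x := _^-1)) ?invr_gt0 // ler_pM2r ?invr_gt0 // distrC.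
(* Here [phi] is reached around the end of the register, which costs one more period. *)
apply: (near_E (e := ((f + i) %/ M)%N%:Z - 1)).
rewrite shift_divn intrB -pmulrn.
rewrite (_ : _ - _ = pi * ((M%:R - i%:R + d) / M%:R)); last first.
  by move: M%:R M0 => N N0; field; rewrite gt_eqF.
rewrite ger0_norm; last first.
  rewrite !mulr_ge0 ?invr_ge0 ?(ltW p0) ?(ltW M0) //.
  case/andP: d01 => d0 _; rewrite addr_ge0 // subr_ge0 ler_nat.
  exact: ltnW.
by rewrite -mulrA ler_pM2l // ler_pM2r ?invr_gt0.
Qed.

Let sum_shift (P : pred 'I_M) :
  \sum_(y < M | P y) fejer M (phi - pi * y%:R / M%:R) =
  \sum_(i < M | P (shift i)) fejer M (pi * (i%:R - d) / M%:R).
Proof.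
rewrite (reindex_inj (h := shift)); last exact: addrI.
apply: eq_bigr => i _; rewrite shift_divn fejerDnpi -fejerN.
by congr fejer; rewrite -mulNr -mulrN opprB.
Qed.

(** An outcome outside [E] has offset [i] with [k < i - d] and [k < M - i + d]. In [fejer_le] at
    [r = i - d], the distances are at least [i - 1 >= k] and [M - i >= k], so each of the two sums
    is a quarter of an inverse-square tail. *)
Lemma phase_estimate_tail : (1 < k)%N ->
  \sum_(y < M | ~~ E y) fejer M (phi - pi * y%:R / M%:R) < 1 / (2 * (k%:R - 1)).
Proof.
move=> k1; case/andP: (d01) => d0 d1; rewrite sum_shift.
have k0 : 0 < k%:R :> R by rewrite ltr0n ltnW.
have k1R : 0 < k%:R - 1 :> R by rewrite subr_gt0 ltr1n.
pose u (i : nat) : R := (i%:R - 1) ^- 2 / 4.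
pose v (i : nat) : R := (M%:R - i%:R) ^- 2 / 4.
apply: (@le_lt_trans _ _ (\sum_(i < M | (k < i)%N) u i + \sum_(i < M | (k <= M - i)%N) v i)).
  rewrite big_mkcond [X in _ <= X + _]big_mkcond [X in _ <= _ + X]big_mkcond /=.
  rewrite -big_split; apply: ler_sum => i _ /=.
  have u0 : 0 <= u i by rewrite divr_ge0 ?invr_ge0 ?sqr_ge0.
  have v0 : 0 <= v i by rewrite divr_ge0 ?invr_ge0 ?sqr_ge0.
  case: ifPn => [nE|_]; last by rewrite addr_ge0 //; case: ifP.
  have iM : i%:R + 1 <= M%:R :> R by rewrite natr1 ler_nat.
  have h2 : k%:R < M%:R - i%:R + d.
    by rewrite ltNge; apply: contra nE => h; apply: near_shift; right.
  have h1 : k%:R < `|i%:R - d|.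
    by rewrite ltNge; apply: contra nE => h; apply: near_shift; left.
  (* The other sign would give [k < d < 1]. *)
  have {}h1 : k%:R < i%:R - d.
    have i0 := ler0n R i.
    move: h1; case: (ger0P (i%:R - d)) => // _ h.
    by have : 1 < k%:R :> R; [rewrite ltr1n | lra].
  have -> : (k < i)%N by rewrite -(ltr_nat R); lra.
  have -> : (k <= M - i)%N.
    by rewrite -ltnS -(ltr_nat R) -natr1 natrB ?(ltnW (ltn_ord i)) //; lra.
  have r0M : 0 < i%:R - d < M%:R by lra.
  apply: le_trans (fejer_le r0M) _; rewrite /u /v -mulrDl ler_pM2r ?invr_gt0 //.
  by rewrite lerD // lef_pV2 ?posrE ?exprn_gt0 ?ler_sqr ?nnegrE //; lra.
rewrite -!mulr_suml.
have S1 : \sum_(i < M | (k < i)%N) (i%:R - 1) ^- 2 < (k%:R - 1)^-1 :> R.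
  rewrite big_mkcond big_ord_recl /= add0r.
  under eq_bigr do rewrite /= /bump /= add1n ltnS -natr1 addrK.
  by rewrite -big_mkcond sum_inv_sqr_tail_lt.
have S2 : \sum_(i < M | (k <= M - i)%N) (M%:R - i%:R) ^- 2 < (k%:R - 1)^-1 :> R.
  apply: le_lt_trans (sum_inv_sqr_tail_lt M.+1 k1).
  rewrite big_mkcond [leRHS]big_mkcond [leRHS]big_ord_recl /= (leqNgt k 0) (ltnW k1) /= add0r.
  (* Reversal turns [M - i] into [i + 1], which matches the tail over [M.+1] indices once index 0 is
     removed. *)
  rewrite (reindex_inj rev_ord_inj) /=; apply: ler_sum => i _.
  by rewrite -natrB ?subKn ?leq_subr // lift0.
rewrite -mulrDl ltr_pdivrMr // invfM mul1r; lra.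
Qed.

(** Offsets 0 and 1 are the two grid points around [phi], at [d] and [1 - d] steps; both lie in [E],
    and [inv_sqr_distance_sum_ge] bounds their joint mass. *)
Lemma phase_estimate_near : k = 1%N ->
  8 / pi ^+ 2 <= \sum_(y < M | E y) fejer M (phi - pi * y%:R / M%:R).
Proof.
move=> k1; case/andP: (d01) => d0 d1.
have p0 := @pi_gt0 R.
have p8 : 8 / pi ^+ 2 <= 1 :> R.
  by have p3 := @pi_ge3 R; rewrite ler_pdivrMr ?exprn_gt0 //; nra.
have E0 : E (shift ord0).
  by apply: near_shift; left; rewrite k1 /= sub0r normrN ger0_norm ?(ltW d1).
(* For [M = 1] the two offsets coincide, and the only outcome carries all the mass. *)
have [m0|m0] := posnP m.
  have z0 (z : 'I_M) : z = ord0.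
    apply: val_inj; apply/eqP; rewrite -leqn0.
    exact: leq_trans (leq_ord z) (eq_leq m0).
  apply: le_trans p8 _; rewrite -[leLHS](sum_fejer phi (ltn0Sn m)) [leRHS]big_mkcond /=.
  apply: ler_sum => y _; suff -> : E y by [].
  by rewrite (z0 y) -(z0 (shift ord0)).
have o1 : (inord 1 : 'I_M) = 1%N :> nat by rewrite inordK.
have E1 : E (shift (inord 1)).
  apply: near_shift; left; rewrite k1 o1 ger0_norm; last by rewrite subr_ge0 ltW.
  by rewrite lerBlDr lerDl.
rewrite sum_shift (bigD1 ord0) //= (bigD1 (inord 1)) /=; last first.
  by rewrite E1 -val_eqE /= o1.
rewrite o1 addrA; apply: (@le_trans _ _
  (fejer M (pi * (0 - d) / M%:R) + fejer M (pi * (1 - d) / M%:R))); last first.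
  by rewrite lerDl sumr_ge0 // => i _; exact: fejer_ge0.
have -> : fejer M (pi * (0 - d) / M%:R) = fejer M (pi * d / M%:R).
  by rewrite -fejerN sub0r mulrN mulNr opprK.
(* At [d = 0] the phase is a grid point, of mass 1; this case is set apart because [d] is inverted
   below. *)
move: d0; rewrite le_eqVlt => /predU1P[<-|d0].
  by rewrite mulr0 mul0r fejer0 // (le_trans p8) // lerDl fejer_ge0.
have M1 : 1 <= M%:R :> R by rewrite ler1n.
have := inv_sqr_distance_sum_ge (d := d); rewrite d0 d1 => /(_ isT).
have /fejer_ge : 0 <= d <= M%:R by lra.
have /fejer_ge : 0 <= 1 - d <= M%:R by lra.
rewrite (_ : pi * (1 - d) = - (pi * d) + pi); last by ring.
rewrite sinDpi sinN opprK (_ : - (pi * d) + pi = pi * (1 - d)); last by ring.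
move: (fejer _ _) (fejer _ _) (sin _) => F G s hG hF h8.
rewrite ler_pdivrMr ?exprn_gt0 //; apply: le_trans h8 _.
have e1 : s ^+ 2 / d ^+ 2 <= F * pi ^+ 2.
  by rewrite ler_pdivrMr ?exprn_gt0 // -mulrA -exprMn.
have e2 : s ^+ 2 / (1 - d) ^+ 2 <= G * pi ^+ 2.
  by rewrite ler_pdivrMr ?exprn_gt0 ?subr_gt0 // -mulrA -exprMn.
by rewrite mulrDr mulrDl lerD.
Qed.

End Window.
End PhaseEstimation.

(** * The operator [Q] on the good-bad plane and the output distribution *)

Section AmplitudeEstimation.
Variables (R : realType) (n : nat) (lab : 'I_n.+1 -> nat) (i0 : 'I_n.+1).
Variables (chi : int -> bool) (A : 'M[R[i]]_n.+1).
Hypothesis A_unitary : unitary_mx A.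
Local Notation psi := (Psi i0 A).
Local Notation a := (amp lab i0 chi A).
Local Notation good := (good lab chi).
Local Notation Q := (Qop lab i0 chi A).
Implicit Types (p : R * R) (x : 'I_n.+1).

Lemma sum_normsq_Psi : \sum_x normsq (psi x 0) = 1.
Proof.
rewrite unitary_sum_normsq; last by case: A_unitary.
rewrite (bigD1 i0) //= big1 => [|x xi]; rewrite mxE /normsq /=.
  by rewrite !eqxx /= expr1n expr0n !addr0.
by rewrite (negbTE xi) /= expr0n addr0.
Qed.

Lemma sum_normsq_bad : \sum_(x | ~~ good x) normsq (psi x 0) = 1 - a.
Proof. by rewrite -[1 in RHS]sum_normsq_Psi [in RHS](bigID good) /= addrAC subrr add0r. Qed.

Lemma amp_ge0_le1 : 0 <= a <= 1.
Proof.
rewrite sumr_ge0 => [|x _]; last exact: normsq_ge0.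
by rewrite -subr_ge0 -sum_normsq_bad sumr_ge0 // => x _; exact: normsq_ge0.
Qed.

(* The vector [p.1 |Psi_1> + p.2 |Psi_0>], where [Psi_1] and [Psi_0] are the
   components of [Psi] along the good and the bad basis states. *)
Definition good_bad p : 'cV[R[i]]_n.+1 :=
  \col_x ((if good x then p.1 else p.2)%:C%C * psi x 0).

(** [Q] is [2 psi psi^* - 1] composed with [S_chi]; [r] is twice the inner product of [psi] with
    [S_chi] applied to the vector. *)
Definition grover_step p : R * R :=
  let r := 2 * (p.2 * (1 - a) - p.1 * a) in (p.1 + r, - p.2 + r).

Definition grover_coef (j : nat) : R * R := iter j grover_step (1, 1).

Lemma inner_Psi_good_bad p :
  (adjmx psi *m good_bad p) 0 0 = (p.1 * a + p.2 * (1 - a))%:C%C.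
Proof.
rewrite -sum_normsq_bad rmorphD !rmorphM !rmorph_sum !big_distrr /=.
rewrite mxE (bigID good) /=; congr (_ + _); apply: eq_bigr => x gx;
  by rewrite !mxE ?gx ?(negbTE gx) mulrCA -normsqE.
Qed.

Lemma S_chi_good_bad p : S_chi R lab chi *m good_bad p = good_bad (- p.1, p.2).
Proof.
apply/matrixP => x z; rewrite ord1 !mxE (bigD1 x) //= big1 => [|y yx].
  by rewrite !mxE eqxx addr0; case: ifP => _ /=; rewrite ?rmorphN ?mulN1r ?mulNr ?mul1r.
by rewrite !mxE eq_sym (negbTE yx) mul0r.
Qed.

(** [S_0] is the reflection [1 - 2 |0><0|], and conjugation by the unitary [A] carries its axis to
    [psi]. *)
Lemma conj_S_0 : A *m S_0 R i0 *m invmx A = 1%:M - 2 *: (psi *m adjmx psi).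
Proof.
have -> : S_0 R i0 = 1%:M - 2 *: (delta_mx i0 0 *m adjmx (delta_mx i0 0 : 'cV_n.+1)).
  apply/matrixP => x y; rewrite !mxE big_ord1 !mxE !eqxx !andbT.
  have [<-|xy] := eqVneq x y.
    case: eqP => _; last by rewrite mul0r mulr0 subr0.
    by rewrite [conjc _]conjc1 mulr1 mulr1n; ring.
  have [xi|_] := eqVneq x i0; last by rewrite mul0r mulr0 subr0.
  by rewrite -xi eq_sym (negbTE xy) [conjc _]conjc0 !mulr0 subr0.
case: (A_unitary) => AA _; rewrite invmx_unitary // mulmxBr mulmx1 mulmxBl AA.
by rewrite -scalemxAr -scalemxAl mulmxA -(mulmxA _ _ (adjmx A)) -adjmxM.
Qed.

Lemma Qop_good_bad p : Q *m good_bad p = good_bad (grover_step p).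
Proof.
rewrite /Qop conj_S_0 mulNmx -mulmxA S_chi_good_bad mulmxBl mul1mx -scalemxAl -mulmxA.
rewrite [adjmx psi *m _]mx11_scalar mul_mx_scalar inner_Psi_good_bad.
rewrite /good_bad /grover_step; move: a psi => b v.
apply/matrixP => x z; rewrite ord1 !mxE /= (_ : 2 = 2%:C%C); last by rewrite rmorph_nat.
case: ifP => _; rewrite !(rmorphD, rmorphN, rmorphM, rmorphB) /=; ring.
Qed.

Lemma Qop_exp_Psi j : Q ^+ j *m psi = good_bad (grover_coef j).
Proof.
elim: j => [|j IH].
  by rewrite mul1mx; apply/matrixP => x z; rewrite ord1 !mxE; case: ifP; rewrite mul1r.
by rewrite exprS -mulmxE -mulmxA IH Qop_good_bad.
Qed.

Variable theta : R.
Hypothesis sin_theta : sin theta ^+ 2 = a.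

(* Multiplying by [sin theta] and [cos theta] instead of dividing covers the
   degenerate cases [a = 0] and [a = 1]. *)
Lemma grover_coefE j :
  (grover_coef j).1 * sin theta = sin ((2 * j%:R + 1) * theta) /\
  (grover_coef j).2 * cos theta = cos ((2 * j%:R + 1) * theta).
Proof.
elim: j => [|j []]; first by rewrite mulr0 add0r !mul1r.
rewrite /grover_coef iterS -/(grover_coef j); case: (grover_coef j) => g b /= hg hb.
have -> : (2 * j.+1%:R + 1) * theta = (2 * j%:R + 1) * theta + (theta + theta).
  by rewrite -[j.+1%:R]natr1; ring.
move: (_ * theta) hg hb => t hg hb.
rewrite (sinD t) (cosD t) (sinD theta) (cosD theta) -hg -hb -sin_theta -cos2sin2.
have := cos2Dsin2 theta; move: (cos theta) (sin theta) => c s cs1.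
have {}cs1 : c ^+ 2 = 1 - s ^+ 2 by rewrite -cs1 addrK.
by split; ring: cs1.
Qed.

Variables (M : nat) (M_gt0 : (0 < M)%N).

(** The first register starts in [|0>], so the Fourier transform makes it uniform; the inverse
    transform supplies the conjugate phases and the second factor [1 / sqrt M]. *)
Lemma st4E (y : 'I_M) x : st4 lab i0 chi A M y x =
  (M%:R^-1)%:C%C * psi x 0 * \sum_(j < M)
    (if good x then (grover_coef j).1 else (grover_coef j).2)%:C%C
    * expi (- (2 * j%:R * (pi * y%:R / M%:R))).
Proof.
have MR : M%:R != 0 :> R by rewrite pnatr_eq0 -lt0n.
have s2E j z : st2 i0 A M j z = (Num.sqrt M%:R)^-1%:C%C * psi z 0.
  rewrite mxE (bigD1 (Ordinal M_gt0)) //= big1 => [|l l0].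
    by rewrite !mxE /= mul0r mulr0 mul0r expi0 mulr1 addr0.
  by rewrite [X in _ * X]mxE (negbTE (l0 : nat_of_ord l != 0%N)) mulr0.
have s3E j z : st3 lab i0 chi A M j z = (Num.sqrt M%:R)^-1%:C%C *
    ((if good z then (grover_coef j).1 else (grover_coef j).2)%:C%C * psi z 0).
  have := congr1 (fun v : 'cV_n.+1 => v z 0) (Qop_exp_Psi j).
  rewrite mxE [RHS]mxE => <-; rewrite mxE big_distrr /=.
  by apply: eq_bigr => w _; rewrite s2E mulrCA.
rewrite mxE (invmx_unitary (QFT_unitary R M)) mulrAC big_distrr big_distrl /=.
apply: eq_bigr => j _; rewrite s3E adjmxE [QFT _ _ _ _]mxE conjcM conj_expi.
have -> : (M%:R^-1)%:C%C = (Num.sqrt M%:R)^-1%:C%C * conjc (Num.sqrt M%:R)^-1%:C%C :> R[i].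
  by rewrite conjc_real -rmorphM -invfM -expr2 sqr_sqrtr.
have -> : 2 * pi * (y%:R * j%:R) / M%:R = 2 * j%:R * (pi * y%:R / M%:R) :> R by field.
rewrite complexr0; ring.
Qed.

(** Good and bad states contribute the sine sum [U] and the cosine sum [V]. The parallelogram law
    replaces them by [V + i U] and [V - i U], which are geometric sums for the phases [theta] and
    [- theta]; the latter equals [pi - theta] modulo [pi]. *)
Lemma prob_outE (y : 'I_M) : prob_out lab i0 chi A y =
  (fejer M (theta - pi * y%:R / M%:R) + fejer M (pi - theta - pi * y%:R / M%:R)) / 2.
Proof.
set t := pi * y%:R / M%:R.
pose U := \sum_(j < M) (sin ((2 * j%:R + 1) * theta))%:C%C * expi (- (2 * j%:R * t)).
pose V := \sum_(j < M) (cos ((2 * j%:R + 1) * theta))%:C%C * expi (- (2 * j%:R * t)).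
have -> : prob_out lab i0 chi A y = (normsq U + normsq V) / M%:R ^+ 2.
  rewrite /prob_out (bigID good) /=.
  pose W (c : nat -> R) := \sum_(j < M) (c j)%:C%C * expi (- (2 * j%:R * t)).
  (* The weight [a] of the good states is [sin theta ^+ 2], absorbed into the sum by
     [grover_coefE]. *)
  have -> : normsq U = a * normsq (W (fun j => (grover_coef j).1)).
    rewrite -sin_theta -normsq_real -normsqM big_distrr /=; congr normsq.
    apply: eq_bigr => j _; have [<- _] := grover_coefE j.
    by rewrite rmorphM /= [X in X * _]mulrC -[LHS]mulrA.
  have -> : normsq V = (1 - a) * normsq (W (fun j => (grover_coef j).2)).
    rewrite -sin_theta -cos2sin2 -normsq_real -normsqM big_distrr /=; congr normsq.
    apply: eq_bigr => j _; have [_ <-] := grover_coefE j.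
    by rewrite rmorphM /= [X in X * _]mulrC -[LHS]mulrA.
  rewrite -sum_normsq_bad mulrDl !big_distrl /=.
  congr (_ + _); apply: eq_bigr => x gx; rewrite st4E ?gx ?(negbTE gx);
    by rewrite !normsqM normsq_real exprVn -[LHS]mulrA [LHS]mulrC.
have -> : normsq U + normsq V = (normsq (V + 'i%C * U) + normsq (V - 'i%C * U)) / 2.
  by case: U V => [u1 u2] [v1 v2]; rewrite /normsq /=; field.
have -> : fejer M (pi - theta - t) = fejer M (- theta - t).
  by rewrite (_ : pi - theta - t = - theta - t + pi) ?fejerDpi //; ring.
have expiE s : expi s = (cos s)%:C%C + 'i%C * (sin s)%:C%C.
  by apply/eqP; rewrite eq_complex /= !(mul0r, mulr0, mul1r, add0r, addr0, subr0, oppr0) !eqxx.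
have -> : V + 'i%C * U = expi theta * \sum_(j < M) expi (2 * j%:R * (theta - t)).
  rewrite !big_distrr -big_split; apply: eq_bigr => j _ /=.
  by rewrite mulrA -mulrDl -expiE -!expiD; congr expi; ring.
have -> : V - 'i%C * U = expi (- theta) * \sum_(j < M) expi (2 * j%:R * (- theta - t)).
  rewrite !big_distrr -sumrB; apply: eq_bigr => j _ /=.
  rewrite mulrA -mulrBl -mulrN -rmorphN -sinN -cosN -expiE -!expiD; congr expi; ring.
by rewrite !normsqM {1 3}/normsq /= !cos2Dsin2 !mul1r /fejer; field;
  rewrite pnatr_eq0 -lt0n.
Qed.

End AmplitudeEstimation.

(** * From phase errors to errors of the squared sine *)

Section EstimateAccuracy.
Variable R : realType.
Implicit Types (t h phi : R).

Lemma norm_sin_le h : `|sin h| <= `|h|.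
Proof.
wlog h0 : h / 0 <= h.
  by move=> H; case: (lerP 0 h) => hh; [exact: H | rewrite -normrN -sinN -(normrN h) H //; lra].
rewrite (ger0_norm h0) ler_norml sin_le_id // andbT.
have [h1|h1] := lerP h pi; last by have := sin_geN1 h; have := @pi_ge3 R; lra.
by apply: (@le_trans _ _ 0); [lra | apply: sin_ge0_pi; rewrite h0].
Qed.

Lemma sin_sqrDpi_int t (e : int) : sin (t + pi * e%:~R) ^+ 2 = sin t ^+ 2.
Proof.
have sn (s : R) (q : nat) : sin (s + pi * q%:R) ^+ 2 = sin s ^+ 2.
  rewrite mulr_natr (alternatingn (@sinDpi R)) exprMn.
  by rewrite -exprM mulnC exprM sqrrN !expr1n mul1r.
case: e => q; first exact: sn.
by rewrite NegzE rmorphN mulrN -(sn _ q.+1) subrK.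
Qed.

(** The addition formula makes the difference [2 sin h sin phi cos phi cos h + sin h^2 (1 - 2 sin
    phi^2)]; the square root is [|sin phi cos phi|]. *)
Lemma sin_sqr_close phi h : `|sin (phi + h) ^+ 2 - sin phi ^+ 2| <=
  2 * `|h| * Num.sqrt (sin phi ^+ 2 * (1 - sin phi ^+ 2)) + h ^+ 2.
Proof.
rewrite -cos2sin2 -exprMn sqrtr_sqr sinD.
have -> : (sin phi * cos h + cos phi * sin h) ^+ 2 - sin phi ^+ 2 =
    2 * sin h * (sin phi * cos phi) * cos h + sin h ^+ 2 * (1 - 2 * sin phi ^+ 2).
  have := cos2Dsin2 h; have := cos2Dsin2 phi.
  move: (sin h) (cos h) (sin phi) (cos phi) => a b c d e1 e2.
  have {}e1 : d ^+ 2 = 1 - c ^+ 2 by rewrite -e1 addrK.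
  have {}e2 : b ^+ 2 = 1 - a ^+ 2 by rewrite -e2 addrK.
  by ring: e1 e2.
apply: le_trans (ler_normD _ _) _; apply: lerD.
  rewrite !normrM normr_nat -[leRHS]mulr1 ler_pM ?mulr_ge0 ?cos_max //.
  by rewrite ler_wpM2r ?mulr_ge0 // ler_wpM2l // norm_sin_le.
rewrite normrM -[h ^+ 2]mulr1 ler_pM //.
  by rewrite normrX -[h ^+ 2]real_normK ?num_real // ler_sqr ?nnegrE // norm_sin_le.
by rewrite ler_norml; have := sqr_ge0 (sin phi); have := sqr_ge0 (cos phi);
  rewrite cos2sin2; lra.
Qed.

Lemma est_out_close (M k : nat) (y : 'I_M) (e : int) phi :
  `|phi - pi * y%:R / M%:R - pi * e%:~R| <= pi * k%:R / M%:R ->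
  `|est_out R y - sin phi ^+ 2| <=
    2 * pi * k%:R * Num.sqrt (sin phi ^+ 2 * (1 - sin phi ^+ 2)) / M%:R
    + k%:R ^+ 2 * pi ^+ 2 / M%:R ^+ 2.
Proof.
set h := phi - _ - _ => hk.
have -> : est_out R y = sin (phi + - h) ^+ 2.
  rewrite /est_out -(sin_sqrDpi_int _ e) /h; congr (sin _ ^+ 2); ring.
apply: le_trans (sin_sqr_close _ _) _; rewrite normrN sqrrN; apply: lerD.
  rewrite [leRHS]mulrAC ler_wpM2r ?sqrtr_ge0 //.
  by rewrite (_ : 2 * pi * _ / _ = 2 * (pi * k%:R / M%:R)) ?ler_wpM2l // !mulrA.
rewrite -real_normK ?num_real //.
have -> : k%:R ^+ 2 * pi ^+ 2 / M%:R ^+ 2 = (pi * k%:R / M%:R) ^+ 2 :> R.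
  by rewrite !exprMn exprVn (mulrC (pi ^+ 2)).
by rewrite ler_sqr ?nnegrE // (le_trans _ hk).
Qed.

(** [f] and [d] are the integer and fractional parts of [phi M / pi]. *)
Lemma phase_decomposition (M : nat) phi : (0 < M)%N -> 0 <= phi ->
  exists f : nat, exists2 d : R, 0 <= d < 1 & phi = pi * (f%:R + d) / M%:R.
Proof.
move=> M0 phi0; have p0 := @pi_gt0 R; have MR : 0 < M%:R :> R by rewrite ltr0n.
pose x := phi * M%:R / pi.
have x0 : 0 <= x by rewrite divr_ge0 ?mulr_ge0 // ltW.
have /andP[xl xu] := Num.Theory.truncn_itv x0.
exists (Num.truncn x), (x - (Num.truncn x)%:R).
  by rewrite subr_ge0 xl ltrBlDr addrC natr1.
rewrite addrC subrK /x; move: (pi : R) (M%:R : R) p0 MR => p N pp NN.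
by field; rewrite !gt_eqF.
Qed.

Lemma sum_fejer_near_ge (M : nat) (E : pred 'I_M) phi : (0 < M)%N -> 0 <= phi ->
  (forall (y : 'I_M) (e : int),
     `|phi - pi * y%:R / M%:R - pi * e%:~R| <= pi * 1%:R / M%:R -> E y) ->
  8 / pi ^+ 2 <= \sum_(y < M | E y) fejer M (phi - pi * y%:R / M%:R).
Proof.
case: M E => // m E M0 /(phase_decomposition M0)[f [d d01 ->]] hE.
exact: (phase_estimate_near d01 hE).
Qed.

(** Complement of the tail bound, the total mass being 1. *)
Lemma sum_fejer_near_gt (M k : nat) (E : pred 'I_M) phi :
  (0 < M)%N -> (1 < k)%N -> 0 <= phi ->
  (forall (y : 'I_M) (e : int),
     `|phi - pi * y%:R / M%:R - pi * e%:~R| <= pi * k%:R / M%:R -> E y) ->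
  1 - 1 / (2 * (k%:R - 1)) < \sum_(y < M | E y) fejer M (phi - pi * y%:R / M%:R).
Proof.
case: M E => // m E M0 k1 /(phase_decomposition M0)[f [d d01 ->]] hE.
rewrite -[ltLHS]/(1 - _) -{1}(sum_fejer (pi * (f%:R + d) / m.+1%:R) M0) (bigID E) /=.
by rewrite ltrBlDr ltrD2l (phase_estimate_tail d01 hE).
Qed.

End EstimateAccuracy.

Theorem theorem6 (R : realType) (n : nat) (lab : 'I_n.+1 -> nat) (i0 : 'I_n.+1)
  (chi : int -> bool) (A : 'M[R[i]]_n.+1) (M : nat) :
  injective lab -> lab i0 = 0%N -> unitary_mx A -> (0 < M)%N ->
  let a := amp lab i0 chi A in
  let P := prob_out lab i0 chi A (M:=M) in
  (forall y : 'I_M, 0 <= est_out R y <= 1) /\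
  (forall k : nat, (0 < k)%N ->
     let Pk := \sum_(y < M | `|est_out R y - a| <=
                 2 * pi * k%:R * Num.sqrt (a * (1 - a)) / M%:R
                 + k%:R ^+ 2 * pi ^+ 2 / M%:R ^+ 2) P y in
     (k = 1%N -> 8 / pi ^+ 2 <= Pk) /\
     ((2 <= k)%N -> 1 - 1 / (2 * (k%:R - 1)) < Pk)) /\
  (a = 0 -> \sum_(y < M | est_out R y == 0) P y = 1) /\
  (a = 1 -> ~~ odd M -> \sum_(y < M | est_out R y == 1) P y = 1).
Proof.
move=> _ _ A_unitary M0 a P.
have /andP[a0 a1] : 0 <= a <= 1 := amp_ge0_le1 lab i0 chi A_unitary.
have p0 := @pi_gt0 R.
have sa01 : -1 <= Num.sqrt a <= 1.
  by rewrite -{2}sqrtr1 ler_sqrt // a1 andbT (le_trans _ (sqrtr_ge0 a)) // lerN10.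
(* This choice lies in [[0, pi / 2]], so both [theta] and [pi - theta] are nonnegative, as
   [phase_decomposition] requires. *)
pose theta := asin (Num.sqrt a).
have sth : sin theta = Num.sqrt a by rewrite /theta asinK // in_itv.
have sth2 : sin theta ^+ 2 = a by rewrite sth sqr_sqrtr.
have th1 : theta <= pi / 2 by exact: asin_lepi2.
have th0 : 0 <= theta.
  rewrite leNgt; apply/negP => thN.
  have : 0 < sin (- theta).
    by apply: sin_gt0_pi; have := asin_geNpi2 sa01; rewrite -/theta; lra.
  by rewrite sinN sth oppr_gt0 ltNge sqrtr_ge0.
have PE y : P y = (fejer M (theta - pi * y%:R / M%:R)
                   + fejer M (pi - theta - pi * y%:R / M%:R)) / 2.
  exact: prob_outE.
have sumPE (E : pred 'I_M) : \sum_(y | E y) P y =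
    (\sum_(y | E y) fejer M (theta - pi * y%:R / M%:R)
     + \sum_(y | E y) fejer M (pi - theta - pi * y%:R / M%:R)) / 2.
  by rewrite -big_split big_distrl; apply: eq_bigr => y _; exact: PE.
have P0 y : 0 <= P y by rewrite PE divr_ge0 // addr_ge0 // fejer_ge0.
have certain (E : pred 'I_M) y : E y -> P y = 1 -> \sum_(z | E z) P z = 1.
  move=> Ey Py; apply/le_anti/andP; split; last first.
    by rewrite (bigD1 y) //= Py lerDl sumr_ge0.
  have <- : \sum_z P z = 1.
    by rewrite sumPE !sum_fejer //; lra.
  by rewrite [leRHS](bigID E) /= lerDl sumr_ge0.
have th0' : 0 <= pi - theta by lra.
have sth2' : sin (pi - theta) ^+ 2 = a.
  by rewrite addrC sinDpi sqrrN sinN sqrrN.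
split; [|split; [|split]].
- by move=> y; rewrite sqr_ge0 /est_out sin2cos2 lerBlDr lerDl sqr_ge0.
- move=> k k0 /=; rewrite sumPE.
  pose E (y : 'I_M) := `|est_out R y - a| <=
    2 * pi * k%:R * Num.sqrt (a * (1 - a)) / M%:R + k%:R ^+ 2 * pi ^+ 2 / M%:R ^+ 2.
  have nearE phi (y : 'I_M) (e : int) : sin phi ^+ 2 = a ->
      `|phi - pi * y%:R / M%:R - pi * e%:~R| <= pi * k%:R / M%:R -> E y.
    by move=> sphi /est_out_close; rewrite sphi.
  (* Each bound holds for both phases separately, hence for their average. *)
  split=> [k1|k1].
    have near1 := nearE; rewrite k1 in near1.
    have h := sum_fejer_near_ge M0 th0 (fun y e => near1 _ y e sth2).
    have h' := sum_fejer_near_ge M0 th0' (fun y e => near1 _ y e sth2').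
    by rewrite /E in h h'; lra.
  have h := sum_fejer_near_gt M0 k1 th0 (fun y e => nearE _ y e sth2).
  have h' := sum_fejer_near_gt M0 k1 th0' (fun y e => nearE _ y e sth2').
  by rewrite /E in h h'; lra.
(* The phases are 0 and [pi], equal modulo [pi], so outcome 0 has probability 1. *)
- move=> az; have tz : theta = 0.
    apply: (@sin_inj R); rewrite ?in_itv /=; [lra | lra | by rewrite sth az sqrtr0 sin0].
  apply: (certain _ (Ordinal M0)); first by rewrite /est_out /= mulr0 mul0r sin0 expr0n.
  by rewrite PE tz /= mulr0 mul0r !subr0 -[pi]subr0 fejerBpi fejer0 //; lra.
move=> ao Mev.
(* Both phases are [pi / 2], a grid point because [M] is even: outcome [M / 2] is certain. *)
have hM : (M./2 < M)%N by rewrite -divn2 ltn_Pdiv.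
have tz : theta = pi / 2.
  by apply: (@sin_inj R); rewrite ?in_itv /=; [lra | lra | rewrite sth ao sqrtr1 sin_pihalf].
have eM : pi * (M./2)%:R / M%:R = pi / 2 :> R.
  have e : M%:R = (M./2)%:R * 2 :> R.
    by rewrite -natrM muln2 -[in LHS](odd_double_half M) (negbTE Mev).
  rewrite -mulrA; congr (_ * _); rewrite e invfM mulrA divff ?mul1r //.
  by rewrite pnatr_eq0 -lt0n half_gt0; case: (M) M0 Mev => [|[]].
apply: (certain _ (Ordinal hM)); first by rewrite /est_out /= eM sin_pihalf expr1n.
have -> : P (Ordinal hM) = (fejer M 0 + fejer M 0) / 2.
  by rewrite PE /= eM tz subrr (_ : pi - pi / 2 - pi / 2 = 0) //; field.
by rewrite fejer0 //; lra.
Qed.
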